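(* Let $p$ be a prime with $p\equiv 1\pmod 4$, $T=A_p$, $G\in\{A_p,S_p\}$, and let $H=\mathrm{AGL}_1(p)\cap G$ be a maximal subgroup of $G$, with $G$ acting on the cosets of $H$, of degree $n=(p-2)!$. Then $$\mathrm{ifix}(T)=\frac{2^{(p-1)/2}\left(\frac{p-1}{2}\right)!}{p-1},$$ and $1\le \mathrm{ifix}(T)\le n^{1/2}$. In particular there are infinitely many almost simple primitive groups with $1\le \mathrm{ifix}(T)\le n^{1/2}$.
   Context: $\mathrm{AGL}_1(p)$ acts on $\mathbb{F}_p$ by affine maps, embedding it in $S_p$. $\mathrm{ifix}(T)=\max\{\mathrm{fix}(t): t\in T \text{ an involution}\}$, where $\mathrm{fix}(t)$ is the number of fixed points of $t$ on the coset space. *)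

(* Defs.v *)
From mathcomp Require Import all_boot all_order all_algebra all_fingroup all_solvable.
Set Implicit Arguments. Unset Strict Implicit. Unset Printing Implicit Defensive.
Import GRing.Theory.
Local Open Scope group_scope.

Definition AGL1 (p : nat) : {set {perm 'F_p}} :=
  [set s : {perm 'F_p} | [exists a : 'F_p, exists b : 'F_p,
      (a != 0)%R && [forall x, s x == (a * x + b)%R]]].

Definition cfix (gT : finGroupType) (H G : {set gT}) (t : gT) : nat :=
  #|[set C in rcosets H G | C :* t == C]|.

(* ifix(T) = max of fix(t) over involutions t of T (0 if there is none) *)
Definition ifix (gT : finGroupType) (H G T : {set gT}) : nat :=
  \max_(t in T | #[t] == 2) cfix H G t.

(* Main.v *)
(* For p = 1 (mod 4) the involutions of AGL_1(p) are the reflections x |-> b - x: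
   each fixes one point and is a product of (p-1)/2 transpositions, hence even.
   The involutions of Sym(F_p) with a single fixed point form one A_p-class J of
   size p (p-2)!!, meeting H in the p reflections, while no other involution fixes
   a coset of H.  Counting pairs (t, Hx) with t in J and Hx t = Hx gives
   |J| fix(t) = |G : H| p, so fix(t) = (p-2)!/(p-2)!! = 2^k k! where p = 2k+3. *)

Require Import Defs.
From mathcomp Require Import all_boot all_order all_algebra all_fingroup all_solvable.
From mathcomp Require Import finfield ring zify.
Set Implicit Arguments. Unset Strict Implicit. Unset Printing Implicit Defensive.
Import GRing.Theory.
Local Open Scope group_scope.

Fixpoint pairings (m : nat) : nat :=
  if m is m'.+2 then (m'.+1 * pairings m')%N else (m == 0)%N.

Lemma pairings_double k : (pairings k.*2 * (2 ^ k * k`!))%N = (k.*2)`!.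
Proof.
by elim: k => [//|k IHk]; rewrite doubleS /= !factS -IHk expnS -!mul2n; ring.
Qed.

Lemma pairings_cofactor k c :
  (c * pairings (k.+1).*2)%N = (k.*2.+1)`! -> c = (2 ^ k * k`!)%N.
Proof.
move=> ck; apply/eqP; rewrite -(eqn_pmul2r (fact_gt0 k.*2.+1)) -[in X in _ == X]ck.
rewrite factS -pairings_double doubleS /=; apply/eqP; ring.
Qed.

Lemma expn2_fact_sq_leq k : ((2 ^ k * k`!) ^ 2 <= (k.*2.+1)`!)%N.
Proof.
elim: k => [//|k IHk].
have -> : (2 ^ k.+1 * k.+1`! = (k.+1).*2 * (2 ^ k * k`!))%N.
  by rewrite -muln2 expnS factS; ring.
rewrite expnMn doubleS [(_.+3)`!]factS [(_.+2)`!]factS mulnA.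
by apply: leq_mul IHk; rewrite -mulnn leq_mul2r leqnSn orbT.
Qed.

Section Matchings.
Variable T : finType.
Implicit Types (A : {set T}) (s u g : {perm T}).

Definition matching A : {set {perm T}} :=
  [set s : {perm T} | [forall x, if x \in A then (s x != x) && (s (s x) == x) else s x == x]].

Lemma matchingP A s :
  reflect (forall x, if x \in A then (s x != x) && (s (s x) == x) else s x == x)
          (s \in matching A).
Proof. by rewrite inE; apply: forallP. Qed.

Lemma matching_in A s x : s \in matching A -> x \in A ->
  [/\ s x != x, s (s x) = x & s x \in A].
Proof.
move/matchingP=> sA xA; have /[!xA] /andP[sxx /eqP ssx] := sA x; split=> //.
apply: contraT => sxA; have /[!(negbTE sxA)] /eqP ssxsx := sA (s x).
by rewrite ssx in ssxsx; rewrite -ssxsx eqxx in sxx.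
Qed.

Lemma matching_out A s x : s \in matching A -> x \notin A -> s x = x.
Proof. by move/matchingP=> sA /negbTE xA; have /[!xA] /eqP := sA x. Qed.

Lemma matching0 : matching set0 = [set 1].
Proof.
apply/setP=> s; rewrite in_set1; apply/idP/eqP => [sA|->].
  by apply/permP=> x; rewrite perm1 (matching_out sA) ?inE.
by apply/matchingP=> x; rewrite inE perm1 eqxx.
Qed.

Lemma matching_drop A s a : s \in matching A -> a \in A ->
  s * tperm a (s a) \in matching (A :\ a :\ s a).
Proof.
move=> sA aA; have [_ ssa _] := matching_in sA aA.
apply/matchingP => x; rewrite permM !inE.
have [->|xsa] := eqVneq x (s a); first by rewrite ssa tpermL eqxx.
have [->|xa] := eqVneq x a; first by rewrite tpermR eqxx.
have sxa : s x != a by rewrite -{1}ssa (inj_eq perm_inj).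
have sxsa : s x != s a by rewrite (inj_eq perm_inj).
rewrite tpermD 1?eq_sym //=; case xA: (x \in A); last by rewrite (matching_out sA) ?xA.
have [sxx ssx _] := matching_in sA xA.
by rewrite permM ssx tpermD 1?eq_sym // sxx eqxx.
Qed.

Lemma matching_add A s a b : s \in matching (A :\ a :\ b) ->
  a \in A -> b \in A -> a != b -> s * tperm a b \in matching A.
Proof.
move=> sA aA bA ab.
have sa : s a = a by apply: (matching_out sA); rewrite !inE eqxx andbF.
have sb : s b = b by apply: (matching_out sA); rewrite !inE eqxx.
apply/matchingP => x; rewrite !permM.
have [->|xa] := eqVneq x a; first by rewrite aA sa tpermL sb tpermR eq_sym ab eqxx.
have [->|xb] := eqVneq x b; first by rewrite bA sb tpermR sa tpermL ab eqxx.
have xA : (x \in A :\ a :\ b) = (x \in A) by rewrite !inE xa xb.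
have sxa : a != s x by rewrite eq_sym -sa (inj_eq perm_inj).
have sxb : b != s x by rewrite eq_sym -sb (inj_eq perm_inj).
rewrite (tpermD sxa sxb) -xA.
case: ifP => [xA'|/negbT xA']; last by rewrite (matching_out sA xA') eqxx.
have [sxx ssx _] := matching_in sA xA'.
by rewrite sxx ssx tpermD 1?eq_sym // eqxx.
Qed.

Lemma card_matching_at A a b : a \in A -> b \in A :\ a ->
  #|[set s in matching A | s a == b]| = #|matching (A :\ a :\ b)|.
Proof.
move=> aA /setD1P[ba bA]; apply/eqP; rewrite eqn_leq.
apply/andP; split; rewrite -(card_imset _ (mulIg (tperm a b)));
  apply/subset_leq_card/subsetP => y /imsetP[s].
  by rewrite inE => /andP[sA /eqP <-] ->; apply: matching_drop.
move=> sA ->; rewrite inE matching_add 1?eq_sym //= permM.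
by rewrite (matching_out sA) ?tpermL // !inE eqxx andbF.
Qed.

Lemma card_matching A : #|matching A| = pairings #|A|.
Proof.
have [n ltAn] := ubnP #|A|; elim: n => // n IHn in A ltAn *.
have [A0|[a aA]] := set_0Vmem A; first by rewrite A0 matching0 cards1 cards0.
have cardA : #|A| = (#|A :\ a|).+1 by rewrite (cardsD1 a A) aA.
have -> : #|matching A| = (\sum_(b in A :\ a) #|[set s in matching A | s a == b]|)%N.
  rewrite -sum1_card (partition_big (fun s => s a) (mem (A :\ a))) /=; last first.
    by move=> s sA; have [sa _ saA] := matching_in sA aA; rewrite !inE sa.
  by apply: eq_bigr => b _; rewrite -sum1_card; apply: eq_bigl => s; rewrite inE.
rewrite (eq_bigr (fun _ => pairings #|A :\ a|.-1)) ?sum_nat_const => [|b bA].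
  by rewrite cardA; case: #|A :\ a|.
have cardAb : #|A :\ a :\ b| = #|A :\ a|.-1 by rewrite (cardsD1 b (A :\ a)) bA.
by rewrite card_matching_at // IHn cardAb //; lia.
Qed.

Lemma card_matching_drop A s a : s \in matching A -> a \in A ->
  #|A :\ a :\ s a| = #|A|.-2.
Proof.
move=> sA aA; have [sa _ saA] := matching_in sA aA.
by rewrite [#|A|](cardsD1 a) aA (cardsD1 (s a) (A :\ a)) !inE sa saA.
Qed.

Lemma odd_perm_matching A s : s \in matching A -> odd_perm s = odd #|A|./2.
Proof.
have [n ltAn] := ubnP #|A|; elim: n => // n IHn in A s ltAn *.
have [->|[a aA]] := set_0Vmem A.
  by rewrite matching0 inE => /eqP->; rewrite odd_perm1 cards0.
move=> sA; have [sa _ saA] := matching_in sA aA.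
have cardA := card_matching_drop sA aA.
have A2 : 1 < #|A| by rewrite (cardsD1 a) aA (cardsD1 (s a)) !inE sa saA.
have -> : s = s * tperm a (s a) * tperm a (s a) by rewrite -mulgA tperm2 mulg1.
rewrite odd_permM odd_tperm eq_sym sa (IHn _ _ _ (matching_drop sA aA)) cardA; last by lia.
by case: #|A| A2 => [|[|m]] //= _; rewrite addbT.
Qed.

Lemma matchingJ A s g : s \in matching A -> s ^ g \in matching (g @: A).
Proof.
move=> sA; apply/matchingP => y; rewrite -(permKV g y); set x := g^-1 y.
rewrite permJ (mem_imset _ _ perm_inj) permJ !(inj_eq perm_inj).
case xA : (x \in A); first by have [-> -> _] := matching_in sA xA; rewrite eqxx.
by rewrite (matching_out sA) ?xA.
Qed.

Lemma matching_conj A s u : s \in matching A -> u \in matching A ->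
  exists2 g, perm_on A g & s ^ g = u.
Proof.
have [n ltAn] := ubnP #|A|; elim: n => // n IHn in A s u ltAn *.
have [->|[a aA]] := set_0Vmem A.
  by rewrite matching0 !inE => /eqP-> /eqP->; exists 1; rewrite ?perm_on1 ?conjg1.
move=> sA uA; have [sa _ saA] := matching_in sA aA; have [ua _ uaA] := matching_in uA aA.
set t := tperm (s a) (u a).
have tA : perm_on A t by apply: subset_trans (tperm_on _ _) _; rewrite subUset !sub1set saA.
have ta : t a = a by rewrite tpermD // eq_sym.
have utA : u ^ t \in matching A by rewrite -[in matching A](im_perm_on tA) matchingJ.
have uta : (u ^ t) a = s a by rewrite -{1}ta permJ tpermR.
have := matching_drop utA aA; rewrite uta => utA'.
have A0 : 0 < #|A| by apply/card_gt0P; exists a.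
have [|g gA sgu] := IHn _ _ _ _ (matching_drop sA aA) utA'.
  by rewrite card_matching_drop //; lia.
have ga : g a = a by apply: (out_perm gA); rewrite !inE eqxx andbF.
have gsa : g (s a) = s a by apply: (out_perm gA); rewrite !inE eqxx.
exists (g * t).
  by apply: perm_onM tA; apply: subset_trans gA (subset_trans (subD1set _ _) (subD1set _ _)).
have sg : s ^ g = u ^ t.
  by rewrite -[s]mulg1 -(tperm2 a (s a)) mulgA conjMg sgu tpermJ ga gsa -mulgA tperm2 mulg1.
by rewrite conjgM sg -conjgM tperm2 conjg1.
Qed.

Lemma matching_tpermJ A s z : s \in matching A -> z \in A -> s ^ tperm z (s z) = s.
Proof.
move=> sA zA; have [_ ssz _] := matching_in sA zA.
by apply/conjg_fixP/commgP/commute_sym/commgP/conjg_fixP; rewrite tpermJ ssz tpermC.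
Qed.

Lemma order_matching A s : A != set0 -> s \in matching A -> #[s] = 2.
Proof.
case/set0Pn=> a aA sA; have [sa _ _] := matching_in sA aA.
have s2 : s ^+ 2 = 1.
  apply/permP=> x; rewrite expgS expg1 permM perm1.
  have [xA|xA] := boolP (x \in A); first by case: (matching_in sA xA).
  by rewrite !(matching_out sA xA).
have : #[s] %| 2 by rewrite order_dvdn s2.
have : #[s] != 1%N by rewrite order_eq1; apply: contra sa => /eqP->; rewrite perm1.
by case: #[s] => [|[|[|]]].
Qed.

Lemma imset_permC1 g c : g @: (~: [set c]) = ~: [set g c].
Proof.
apply/setP=> y; rewrite -(permKV g y) (mem_imset _ _ perm_inj) !inE.
by rewrite (inj_eq perm_inj).
Qed.

Definition fix1_invol : {set {perm T}} := \bigcup_c matching (~: [set c]).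

Lemma fix1_involP s : reflect (exists c, s \in matching (~: [set c])) (s \in fix1_invol).
Proof. by apply: (iffP bigcupP) => [[c _]|[c]]; exists c. Qed.

Lemma fix1_involJ g : fix1_invol :^ g = fix1_invol.
Proof.
suff sub h : fix1_invol :^ h \subset fix1_invol.
  by apply/eqP; rewrite eqEsubset sub -{1}(conjsgKV g fix1_invol) conjSg sub.
apply/subsetP=> _ /imsetP[s /fix1_involP[c sc] ->].
by apply/fix1_involP; exists (h c); rewrite -imset_permC1 matchingJ.
Qed.

Lemma matching_fixed_uniq s c d :
  s \in matching (~: [set c]) -> s \in matching (~: [set d]) -> c = d.
Proof.
move=> sc sd; apply/eqP; apply: contraT => cd.
have dc : d \in ~: [set c] by rewrite !inE eq_sym.
have [] := matching_in sc dc.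
by rewrite (matching_out sd) ?eqxx // !inE negbK.
Qed.

Lemma card_fix1_invol : #|fix1_invol| = (#|T| * pairings #|T|.-1)%N.
Proof.
rewrite -sum1_card partition_disjoint_bigcup => [|c d cd]; last first.
  apply/pred0P=> s /=; apply/negbTE/andP=> -[sc sd].
  by rewrite (matching_fixed_uniq sc sd) eqxx in cd.
rewrite -sum_nat_const; apply: eq_bigr => c _.
by rewrite sum1_card card_matching cardsC1.
Qed.

Lemma fix1_invol_Alt_conj s u : 1 < #|T| -> s \in fix1_invol -> u \in fix1_invol ->
  exists2 g, g \in Alt T & s ^ g = u.
Proof.
move=> T1 /fix1_involP[c sc] /fix1_involP[d ud].
have := matchingJ (tperm c d) sc; rewrite imset_permC1 tpermL => sdc.
have [g _ sgu] := matching_conj sdc ud; rewrite -conjgM in sgu.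
have [z zd] : exists z, z \in ~: [set d] by apply/card_gt0P; rewrite cardsC1; lia.
have [uz _ _] := matching_in ud zd.
have [odd_g|even_g] := boolP (odd_perm (tperm c d * g)).
  exists (tperm c d * g * tperm z (u z)).
    by rewrite Alt_even odd_permM odd_g odd_tperm eq_sym uz.
  by rewrite conjgM sgu (matching_tpermJ ud zd).
by exists (tperm c d * g); rewrite ?Alt_even.
Qed.

Lemma order_fix1_invol s : 1 < #|T| -> s \in fix1_invol -> #[s] = 2.
Proof.
move=> T1 /fix1_involP[c sc]; apply: order_matching sc.
by rewrite -card_gt0 cardsC1 -ltnS prednK // ltnW.
Qed.

Lemma fix1_invol_sub_Alt : ~~ odd #|T|.-1./2 -> fix1_invol \subset Alt T.
Proof.
move=> even_half; apply/subsetP=> s /fix1_involP[c sc].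
by rewrite Alt_even (odd_perm_matching sc) cardsC1.
Qed.

End Matchings.

Section CosetFixedPoints.
Variables (gT : finGroupType) (H G : {group gT}).

Lemma rcoset_fixE x t : (H :* x :* t == H :* x) = (t \in H :^ x).
Proof.
rewrite -rcosetM mem_conjg conjgE invgK; apply/eqP/idP => [/rcoset_eqP|tHx].
  by rewrite mem_rcoset mulgA.
by apply/rcoset_eqP; rewrite mem_rcoset -mulgA.
Qed.

Lemma cfix_gt0 t : 0 < cfix H G t -> exists2 x, x \in G & t \in H :^ x.
Proof.
rewrite card_gt0 => /set0Pn[_ /setIdP[/rcosetsP[x xG ->]]].
by rewrite rcoset_fixE; exists x.
Qed.

Lemma leq_cfixJ t g : g \in G -> cfix H G t <= cfix H G (t ^ g).
Proof.
move=> gG; rewrite /cfix -(card_imset _ (@rcoset_inj _ g)); apply: subset_leq_card.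
apply/subsetP=> C /imsetP[D /setIdP[/rcosetsP[x xG ->]]]; rewrite rcoset_fixE => fixHx ->.
rewrite inE -rcosetM rcoset_fixE conjsgM memJ_conjg fixHx andbT.
by apply/rcosetsP; exists (x * g); rewrite ?groupM.
Qed.

Lemma cfixJ t g : g \in G -> cfix H G (t ^ g) = cfix H G t.
Proof.
move=> gG; apply/eqP; rewrite eqn_leq leq_cfixJ // andbT.
by rewrite -{2}(conjgK g t) leq_cfixJ ?groupV.
Qed.

Lemma sum_cfix (J : {set gT}) : {in G, forall x, J :^ x = J} ->
  (\sum_(t in J) cfix H G t = #|G : H| * #|J :&: H|)%N.
Proof.
move=> JG; have cardE (X : finType) (A : {set X}) (P : pred X) :
    #|[set x in A | P x]| = (\sum_(x in A) P x)%N.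
  by rewrite -sum1dep_card big_mkcondr; apply: eq_bigr => x _; case: (P x).
under eq_bigr => t _ do rewrite /cfix cardE.
rewrite exchange_big /= -sum_nat_const; apply: eq_bigr => _ /rcosetsP[x xG ->].
rewrite -(cardJg _ x) conjIg (JG x xG) -cardE; apply: eq_card => t.
by rewrite !inE rcoset_fixE.
Qed.

End CosetFixedPoints.

Lemma card_setI_Alt (T : finType) (K : {group {perm T}}) o :
  o \in K -> odd_perm o -> (#|K :&: Alt T| * 2)%N = #|K|.
Proof.
move=> oK odd_o; rewrite -(cardsID (Alt T) K) muln2 -addnn; congr (_ + _).
have oddM s : odd_perm (s * o) = ~~ odd_perm s by rewrite odd_permM odd_o addbT.
apply/eqP; rewrite eqn_leq; apply/andP; split;
  rewrite -(card_imset _ (mulIg o)); apply/subset_leq_card/subsetP => y /imsetP[s].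
  by rewrite in_setI in_setD !Alt_even => /andP[sK /negbTE sA] ->; rewrite oddM sA groupM.
by rewrite in_setI in_setD !Alt_even negbK => /andP[sA sK] ->; rewrite oddM sA groupM.
Qed.

Section AffineGroup.
Variable p : nat.
Local Notation F := 'F_p.
Local Open Scope ring_scope.

(* The slope is patched at [a = 0] so that [aff a b] is a permutation for all [a]. *)
Definition aff_fun (a b x : F) : F := ((if a == 0 then 1 else a) * x + b).

Lemma aff_inj a b : injective (aff_fun a b).
Proof.
move=> x y /addIr; apply: mulfI.
by case: ifP => [_|/negbT //]; apply: oner_neq0.
Qed.

Definition aff a b : {perm F} := perm (@aff_inj a b).

Lemma affE a b x : a != 0 -> aff a b x = (a * x + b).
Proof. by move=> a0; rewrite permE /aff_fun (negbTE a0). Qed.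

Lemma AGL1P s : reflect (exists a b, a != 0 /\ s = aff a b) (s \in AGL1 p).
Proof.
rewrite inE; apply: (iffP existsP) => [[a /existsP[b /andP[a0 /forallP sab]]]|[a [b [a0 ->]]]].
  by exists a, b; split => //; apply/permP => x; rewrite affE //; apply/eqP.
by exists a; apply/existsP; exists b; rewrite a0; apply/forallP => x; rewrite affE.
Qed.

Lemma AGL1_group_set : group_set (AGL1 p).
Proof.
apply/group_setP; split.
  apply/AGL1P; exists 1, 0; split; first exact: oner_neq0.
  by apply/permP => x; rewrite affE ?oner_neq0 // mul1r addr0 perm1.
move=> _ _ /AGL1P[a [b [a0 ->]]] /AGL1P[c [d [c0 ->]]]; apply/AGL1P.
exists (c * a), (c * b + d); split; first by rewrite mulf_neq0.
by apply/permP => x; rewrite permM !affE ?mulf_neq0 // mulrDr mulrA addrA.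
Qed.

Canonical AGL1_group := Group AGL1_group_set.

Hypothesis p_pr : prime p.

Lemma card_AGL1 : #|AGL1 p| = (p.-1 * p)%N.
Proof.
have -> : AGL1 p = [set aff ab.1 ab.2 | ab in setX (~: [set 0]) [set: F]].
  apply/setP => s; apply/AGL1P/imsetP => [[a [b [a0 ->]]]|[[a b]]].
    by exists (a, b); rewrite // !inE a0.
  by rewrite !inE andbT => a0 ->; exists a, b.
rewrite card_in_imset ?cardsX ?cardsC1 ?cardsT ?card_Fp // => -[a b] [c d].
rewrite !inE !andbT /= => a0 c0 abcd.
have := congr1 (fun s : {perm F} => s 0) abcd; have := congr1 (fun s : {perm F} => s 1) abcd.
by rewrite /= !affE // !mulr0 !add0r !mulr1 => + bd; rewrite bd => /addIr->.
Qed.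

Lemma expf_Fp_pred (x : F) : x != 0 -> x ^+ p.-1 = 1.
Proof.
move=> x0; apply: (mulfI x0); rewrite -exprS prednK ?prime_gt0 // mulr1.
by rewrite -[X in (x ^+ X)](card_Fp p_pr) expf_card.
Qed.

Lemma Fp_prim_root : exists g : F, (p.-1).-primitive_root g.
Proof.
have p1_gt0 : (0 < p.-1)%N by rewrite -subn1 subn_gt0 prime_gt1.
have units1 : all (p.-1).-unity_root (enum (~: [set 0 : F])).
  by apply/allP => x; rewrite mem_enum !inE unity_rootE => /expf_Fp_pred ->.
have [|g _ gP] := hasP (has_prim_root p1_gt0 units1 (enum_uniq _) _); last by exists g.
by rewrite -cardE cardsC1 card_Fp.
Qed.

Lemma affX a i x : a != 0 -> (aff a 0 ^+ i)%g x = a ^+ i * x.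
Proof.
move=> a0; rewrite permX; elim: i => [|i IHi]; first by rewrite mul1r.
by rewrite iterS IHi affE // addr0 exprS mulrA.
Qed.

Lemma porbits_aff_prim_root g : (p.-1).-primitive_root g ->
  porbits (aff g 0) = [set [set 0]; ~: [set 0]].
Proof.
move=> gP; have g0 : g != 0 by rewrite (prim_root_eq0 gP) -lt0n (prim_order_gt0 gP).
have orbit0 : porbit (aff g 0) 0 = [set 0].
  apply/setP=> y; rewrite inE; apply/porbitP/eqP => [[i ->]|->].
    by rewrite affX // mulr0.
  by exists 0%N; rewrite expg0 perm1.
have orbit_unit x : x != 0 -> porbit (aff g 0) x = ~: [set 0].
  move=> x0; apply/setP=> y; rewrite !inE; apply/porbitP/idP => [[i ->]|y0].
    by rewrite affX // mulf_neq0 // expf_neq0.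
  have [i gi] := prim_rootP gP (expf_Fp_pred (mulf_neq0 y0 (invr_neq0 x0))).
  by exists i; rewrite affX // -gi mulfVK.
apply/setP => C; rewrite !inE; apply/imsetP/orP => [[x _ ->]|[/eqP->|/eqP->]].
- by have [->|/orbit_unit->] := eqVneq x 0; [left; rewrite orbit0 | right].
- by exists 0.
by exists 1; rewrite ?orbit_unit ?oner_neq0.
Qed.

Hypothesis p_odd : odd p.

Lemma odd_perm_AGL1 : exists2 o, o \in AGL1 p & odd_perm o.
Proof.
have [g gP] := Fp_prim_root.
have g0 : g != 0 by rewrite (prim_root_eq0 gP) -lt0n (prim_order_gt0 gP).
exists (aff g 0); first by apply/AGL1P; exists g, 0.
rewrite /odd_perm card_Fp // porbits_aff_prim_root // cards2 p_odd /= negbK oddb.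
by apply/eqP => /setP/(_ 0); rewrite !inE eqxx.
Qed.

Lemma two_Fp_neq0 : (2%:R : F) != 0.
Proof.
apply/eqP => /(congr1 (fun x : F => nat_of_ord x)).
by rewrite val_Fp_nat // modn_small // odd_prime_gt2.
Qed.

Lemma aff_N1_fix (b x : F) : (aff (-1) b x == x) = (x == b / 2%:R).
Proof.
rewrite affE ?oppr_eq0 ?oner_neq0 // mulN1r addrC subr_eq -mulr2n -[_ *+ 2]mulr_natr.
by apply/eqP/eqP => [->|->]; rewrite ?mulfK ?divfK ?two_Fp_neq0.
Qed.

Lemma aff_N1_invol b x : aff (-1) b (aff (-1) b x) = x.
Proof. by rewrite !affE ?oppr_eq0 ?oner_neq0 // !mulN1r opprD opprK addrNK. Qed.

Lemma aff_N1_fix1_invol b : aff (-1) b \in fix1_invol F.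
Proof.
apply/fix1_involP; exists (b / 2%:R); apply/matchingP => x.
by rewrite !inE aff_N1_fix aff_N1_invol eqxx andbT; case: (_ == _).
Qed.

Lemma AGL1_involution s : s \in AGL1 p -> #[s] = 2 -> exists b, s = aff (-1) b.
Proof.
case/AGL1P => a [b [a0 ->{s}]] s2; exists b.
have ssx x : aff a b (aff a b x) = x.
  by have /permP/(_ x) := expg_order (aff a b); rewrite s2 expgS expg1 permM perm1.
have := ssx 0; have := ssx 1; rewrite !affE // mulr0 add0r mulr1 => a_ab ab0.
have /eqP : (a - 1) * (a + 1) = 0.
  have -> : (a - 1) * (a + 1) = a * (a + b) + b - (a * b + b) - 1 by ring.
  by rewrite a_ab ab0 subr0 subrr.
rewrite mulf_eq0 subr_eq0 addr_eq0 => /orP[/eqP a1|/eqP ->] //.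
have b0 : b = 0.
  apply: (mulIf two_Fp_neq0); rewrite mul0r mulr_natr mulr2n.
  by move: ab0; rewrite a1 mul1r.
suff ab1 : aff a b = 1%g by move: s2; rewrite ab1 order1.
by apply/permP => x; rewrite affE // a1 b0 mul1r addr0 perm1.
Qed.

Lemma AGL1_fix1_invol : fix1_invol F :&: AGL1 p = [set aff (-1) b | b : F].
Proof.
have F1 : (1 < #|F|)%N by rewrite card_Fp // prime_gt1.
apply/setP => s; apply/setIP/imsetP => [[sJ sA]|[b _ ->]].
  by have [|b ->] := AGL1_involution sA; [exact: order_fix1_invol | exists b].
by split; [exact: aff_N1_fix1_invol | apply/AGL1P; exists (-1), b; rewrite oppr_eq0 oner_neq0].
Qed.

Lemma card_AGL1_fix1_invol : #|fix1_invol F :&: AGL1 p| = p.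
Proof.
rewrite AGL1_fix1_invol card_imset ?card_Fp // => b c /(congr1 (fun s : {perm F} => s 0)).
by rewrite !affE ?oppr_eq0 ?oner_neq0 // !mulr0 !add0r.
Qed.

End AffineGroup.

Section AlternatingCase.
Variables (p : nat) (G : {group {perm 'F_p}}).
Hypotheses (p_pr : prime p) (p_mod4 : (p %% 4 = 1)%N) (AltG : Alt 'F_p \subset G).
Local Notation F := 'F_p.
Local Notation H := (AGL1 p :&: G).
Local Notation J := (fix1_invol F).

Lemma odd_p_mod4 : odd p.
Proof. by rewrite (divn_eq p 4) p_mod4 addn1 /= oddM andbF. Qed.

Lemma fix1_invol_sub_Alt_Fp : J \subset Alt F.
Proof.
apply: fix1_invol_sub_Alt; rewrite card_Fp // (divn_eq p 4) p_mod4 addn1 /=.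
by rewrite -[4]/(2 * 2)%N mulnA muln2 doubleK oddM andbF.
Qed.

Lemma cfix_fix1_invol_eq t u : t \in J -> u \in J -> cfix H G t = cfix H G u.
Proof.
move=> tJ uJ; have [|g gAlt <-] := fix1_invol_Alt_conj _ tJ uJ.
  by rewrite card_Fp // prime_gt1.
by rewrite cfixJ // (subsetP AltG).
Qed.

Lemma cfix_fix1_invol t : t \in J -> (cfix H G t * pairings p.-1)%N = #|G : H|.
Proof.
move=> tJ; apply/eqP; rewrite -(eqn_pmul2r (prime_gt0 p_pr)).
have JG : J \subset G := subset_trans fix1_invol_sub_Alt_Fp AltG.
have JH : J :&: H = J :&: AGL1 p by rewrite setIA (setIidPl (subset_trans (subsetIl _ _) JG)).
have : (\sum_(u in J) cfix H G u = #|G : H| * #|J :&: H|)%N.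
  exact: @sum_cfix _ (AGL1_group p :&: G)%G G J (fun x _ => fix1_involJ x).
rewrite (eq_bigr _ (fun u uJ => cfix_fix1_invol_eq uJ tJ)) sum_nat_const.
rewrite JH card_AGL1_fix1_invol ?odd_p_mod4 // card_fix1_invol card_Fp // => <-.
by apply/eqP; ring.
Qed.

Lemma fix1_invol_cfix_gt0 t : #[t] = 2 -> 0 < cfix H G t -> t \in J.
Proof.
move=> t2 /cfix_gt0[x xG]; rewrite mem_conjg => /setIP[tA _].
have [|b tb] := AGL1_involution p_pr odd_p_mod4 tA; first by rewrite orderJ.
by rewrite -(fix1_involJ x) mem_conjg tb aff_N1_fix1_invol ?odd_p_mod4.
Qed.

Lemma ifix_AGL1 : ifix H G (Alt F) = cfix H G (aff (-1) 0)%R.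
Proof.
have t0J : (aff (-1) 0)%R \in J by apply: aff_N1_fix1_invol; rewrite ?odd_p_mod4.
apply/eqP; rewrite eqn_leq; apply/andP; split.
  apply/bigmax_leqP => t /andP[_ /eqP t2].
  have [->|/(fix1_invol_cfix_gt0 t2) tJ] := posnP (cfix H G t); first exact: leq0n.
  by rewrite (cfix_fix1_invol_eq tJ t0J).
apply: leq_bigmax_cond; rewrite (subsetP fix1_invol_sub_Alt_Fp) //=.
by rewrite order_fix1_invol // card_Fp // prime_gt1.
Qed.

End AlternatingCase.

Lemma index_AGL1 p (G : {group {perm 'F_p}}) : prime p -> odd p ->
  G :=: Alt 'F_p \/ G :=: Sym 'F_p -> #|G : AGL1 p :&: G| = (p - 2)`!.
Proof.
move=> p_pr p_odd hG; have p_gt1 := prime_gt1 p_pr.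
have p_fact : p`! = (p.-1 * p * (p - 2)`!)%N.
  by case: p p_gt1 {p_pr p_odd G hG} => [|[|m]] // _; rewrite subn2 !factS /= mulnA (mulnC m.+1).
have AGL1_gt0 : (0 < p.-1 * p)%N by rewrite muln_gt0 -subn1 subn_gt0 p_gt1 prime_gt0.
apply/eqP; rewrite -(eqn_pmul2l AGL1_gt0) -p_fact.
have [GE|GE] := hG; rewrite GE.
  have [o oA odd_o] := odd_perm_AGL1 p_pr p_odd.
  rewrite -(card_AGL1 p_pr) -(card_setI_Alt oA odd_o) mulnAC Lagrange ?subsetIr //.
  by rewrite mulnC card_Alt // card_Fp.
rewrite (setIidPl (subsetT _)) -(card_AGL1 p_pr) Lagrange ?subsetT //.
by rewrite card_Sym card_Fp.
Qed.

Local Close Scope group_scope.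

Theorem mainTheorem10 (p : nat) (G : {group {perm 'F_p}}) :
  prime p -> p %% 4 = 1 ->
  (G :=: Alt 'F_p \/ G :=: Sym 'F_p) ->
  maximal (AGL1 p :&: G) G ->
  let H := AGL1 p :&: G in
  let n := (#|G : H|)%g in
  let T := Alt 'F_p in
  n = (p - 2)`! /\
  ((ifix H G T)%:Q = (2 ^ ((p - 1) %/ 2) * ((p - 1) %/ 2)`!)%N%:Q / (p - 1)%N%:Q)%R /\
  1 <= ifix H G T /\ ifix H G T ^ 2 <= n.
Proof.
move=> p_pr p_mod4 hG _ H n T.
have p_odd := odd_p_mod4 p_mod4.
have AltG : Alt 'F_p \subset G by case: hG => ->; rewrite ?subxx ?Alt_subset.
have [k pk] : exists k, p = k.+1.*2.+1.
  exists (p %/ 4 * 2).-1; have := prime_gt1 p_pr; lia.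
have n_fact : n = (p - 2)`! by apply: index_AGL1.
have half_p : ((p - 1) %/ 2)%N = k.+1 by rewrite pk; lia.
have pred_p : (p - 1)%N = k.+1.*2 by rewrite pk; lia.
have p_sub2 : (p - 2)%N = k.*2.+1 by rewrite pk; lia.
have ifixE : ifix H G T = (2 ^ k * k`!)%N.
  rewrite /T ifix_AGL1 //; apply: pairings_cofactor.
  rewrite -pred_p subn1 -p_sub2 -n_fact /n.
  exact: cfix_fix1_invol (aff_N1_fix1_invol p_pr p_odd 0%R).
rewrite ifixE half_p pred_p n_fact p_sub2.
split=> //; split; last by rewrite muln_gt0 expn_gt0 fact_gt0 expn2_fact_sq_leq.
rewrite expnS factS -mul2n.
have -> : (2 * 2 ^ k * (k.+1 * k`!) = 2 ^ k * k`! * (2 * k.+1))%N by ring.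
by rewrite [in RHS]PoszM [in RHS]intrM mulfK // intr_eq0.
Qed.
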